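(* Let $\mathfrak C$ be a left cancellative small category. The canonical projection $I_l\ltimes\partial\Omega\twoheadrightarrow I_l\,\bar\ltimes\,\partial\Omega$ is an isomorphism (of topological groupoids) if one of the following holds: (i) The canonical projection $I_l\ltimes\Omega\twoheadrightarrow I_l\,\bar\ltimes\,\Omega$ is an isomorphism. (ii) $I_l\ltimes\partial\Omega$ is Hausdorff. (iii) $\partial\Omega=\Omega_{\max}$.
   Context: $\mathfrak C$ denotes the set of morphisms, $\mathfrak C^0\subseteq\mathfrak C$ the identity morphisms, $\mathfrak d,\mathfrak t$ domain and target; $cd$ is defined iff $\mathfrak d(c)=\mathfrak t(d)$; left cancellative means $cx=cy\Rightarrow x=y$. Each $c\in\mathfrak C$ gives the partial bijection $\mathfrak d(c)\mathfrak C\to c\mathfrak C$, $x\mapsto cx$; $I_l$ is the smallest semigroup of partial bijections of $\mathfrak C$ containing these and closed under inverses; $\mathcal J=\{\mathrm{dom}(s):s\in I_l\}$ is its semilattice of idempotents (product = intersection). $\bar{\mathcal J}$ is the set of subsets $\varepsilon=e\setminus\bigcup_{i=1}^nf_i$ with $e,f_i\in\mathcal J$, $f_i\subseteq e$. $\widehat{\mathcal J}$ is the space of non-zero multiplicative maps $\chi:\mathcal J\to\{0,1\}$ with $\chi(\emptyset)=0$ if $\emptyset\in\mathcal J$ (pointwise convergence). $\Omega\subseteq\widehat{\mathcal J}$ consists of those $\chi$ such that whenever $e=\bigcup_{i=1}^nf_i$ ($e,f_i\in\mathcal J$) and $\chi(e)=1$, then $\chi(f_i)=1$ for some $i$. $\Omega_{\max}\subseteq\Omega$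 is the set of $\chi\in\widehat{\mathcal J}$ with $\chi^{-1}(1)$ maximal, and $\partial\Omega=\overline{\Omega_{\max}}$. For $\chi\in\Omega$, $\varepsilon=e\setminus\bigcup f_i\in\bar{\mathcal J}$, put $\chi(\varepsilon)=1$ iff $\chi(e)=1$ and all $\chi(f_i)=0$, and $\chi(\varepsilon)=0$ otherwise. $s\in I_l$ acts by $\chi\mapsto s.\chi=\chi(s^{-1}\cdot s)$ from $\{\chi\in\Omega:\chi(s^{-1}s)=1\}$ onto $\{\chi\in\Omega:\chi(ss^{-1})=1\}$; $\partial\Omega$ is invariant. For $Y=\Omega$ or $Y=\partial\Omega$: $I_l\ltimes Y$ is the quotient of $\{(s,\chi)\in I_l\times Y:\chi(s^{-1}s)=1\}$ by $(s,\chi)\sim(t,\psi)$ iff $\chi=\psi$ and $se=te$ for some $e\in\mathcal J$ with $\chi(e)=1$; $I_l\,\bar\ltimes\,Y$ is the quotient by $(s,\chi)\bar\sim(t,\psi)$ iff $\chi=\psi$ and $s\varepsilon=t\varepsilon$ for some $\varepsilon\in\bar{\mathcal J}$ with $\chi(\varepsilon)=1$ (restrictions as partial bijections). Both are groupoids with source $\chi$, range $s.\chi$, $[s,t.\chi][t,\chi]=[st,\chi]$, topologized such that the images of $\{s\}\times\{\chi\in Y:\chi(s^{-1}s)=1\}$ are open and mapped homeomorphically by the source map onto $\{\chi\in Y:\chi(s^{-1}s)=1\}$. The canonical projections send $\sim$-classes to $\bar\sim$-classes. *)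

(* Defs.v *)
From HB Require Import structures.
From mathcomp Require Import all_boot.
From mathcomp Require Import all_classical topology function_spaces.

Set Implicit Arguments.
Unset Strict Implicit.
Unset Printing Implicit Defensive.

Local Open Scope classical_set_scope.

(* A small category given by its morphisms only.  [ccomp c d] is meaningful
   only when [cdom c = ctgt d]; other values are unspecified. *)
Record smallCategory := SmallCategory {
  mor :> Type;
  idm : set mor;
  cdom : mor -> mor;
  ctgt : mor -> mor;
  ccomp : mor -> mor -> mor;
  cdom_id : forall c, idm (cdom c);
  ctgt_id : forall c, idm (ctgt c);
  idm_dom : forall x, idm x -> cdom x = x;
  idm_tgt : forall x, idm x -> ctgt x = x;
  cdom_comp : forall c d, cdom c = ctgt d -> cdom (ccomp c d) = cdom d;
  ctgt_comp : forall c d, cdom c = ctgt d -> ctgt (ccomp c d) = ctgt c;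
  comp1c : forall c, ccomp (ctgt c) c = c;
  compc1 : forall c, ccomp c (cdom c) = c;
  ccompA : forall b c d, cdom b = ctgt c -> cdom c = ctgt d ->
    ccomp b (ccomp c d) = ccomp (ccomp b c) d }.

Definition left_cancellative (C : smallCategory) := forall c x y : C,
  cdom c = ctgt x -> cdom c = ctgt y -> ccomp c x = ccomp c y -> x = y.

Record lcCategory := LcCategory {
  lc_cat :> smallCategory;
  lc_catP : left_cancellative lc_cat }.

(* Partial bijections of [T], identified with their graphs. *)
Record pbij (T : Type) := PBij {
  graph :> T * T -> Prop;
  graph_fun : forall x y z, graph (x, y) -> graph (x, z) -> y = z;
  graph_inj : forall x y z, graph (x, z) -> graph (y, z) -> x = y }.

HB.instance Definition _ T := gen_eqMixin (pbij T).
HB.instance Definition _ T := gen_choiceMixin (pbij T).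

Lemma pbij_eq T (s t : pbij T) : graph s = graph t -> s = t.
Proof.
case: s t => [s s1 s2] [t t1 t2] /= st; subst t.
by congr PBij; exact: Prop_irrelevance.
Qed.

Section PartialBijections.
Context {T : Type}.
Implicit Types (s t : pbij T) (A : set T).

Definition pdom s : set T := [set x | exists y, s (x, y)].

Definition ppre s A : set T := [set x | exists2 y, s (x, y) & A y].

Program Definition pinv s : pbij T := @PBij T (graph s)^-1%relation _ _.
Next Obligation. by move=> s x y z /= sy sz; exact: graph_inj sy sz. Qed.
Next Obligation. by move=> s x y z /= sy sz; exact: graph_fun sy sz. Qed.

(* [pcomp s t] is [s] after [t]. *)
Program Definition pcomp s t : pbij T :=
  @PBij T (graph s \; graph t)%relation _ _.
Next Obligation.
move=> s t x y z [u /= tu su] [v /= tv sv].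
by move: sv; rewrite -(graph_fun tu tv); exact: graph_fun su.
Qed.
Next Obligation.
move=> s t x y z [u /= tu su] [v /= tv sv].
by move: tv; rewrite -(graph_inj su sv); exact: graph_inj tu.
Qed.

Program Definition prestr s A : pbij T :=
  @PBij T [set p | graph s p /\ A p.1] _ _.
Next Obligation. by move=> s A x y z [+ _] [+ _]; exact: graph_fun. Qed.
Next Obligation. by move=> s A x y z [+ _] [+ _]; exact: graph_inj. Qed.

Program Definition pid A : pbij T := @PBij T [set p | A p.1 /\ p.1 = p.2] _ _.
Next Obligation. by move=> A x y z /= [_ <-] [_ <-]. Qed.
Next Obligation. by move=> A x y z /= [_ ->] [_ ->]. Qed.

Lemma prestrP s t A : prestr s A = prestr t A <->
  forall x y, A x -> s (x, y) <-> t (x, y).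
Proof.
split=> [st x y Ax|st]; last first.
  by apply/pbij_eq/seteqP; split=> -[x y] /= [sxy Ax];
    split => //; exact/(st x y Ax).
have /seteqP[/(_ (x, y)) /= st1 /(_ (x, y)) /= st2] := congr1 (@graph T) st.
by split=> [sxy|txy]; [have [] := st1 (conj sxy Ax)|have [] := st2 (conj txy Ax)].
Qed.

End PartialBijections.

Program Definition lmul (C : lcCategory) (c : C) : pbij C :=
  @PBij C [set p | cdom c = ctgt p.1 /\ p.2 = ccomp c p.1] _ _.
Next Obligation. by move=> C c x y z /= [_ ->] [_ ->]. Qed.
Next Obligation.
by move=> C c x y z /= [cx ->] [cy]; exact: (@lc_catP C c x y cx cy).
Qed.

Inductive Il (C : lcCategory) : set (pbij C) :=
| Il_lmul c : Il (lmul c)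
| Il_pinv s : Il s -> Il (pinv s)
| Il_pcomp s t : Il s -> Il t -> Il (pcomp s t).
Arguments Il : clear implicits.

Definition J (C : lcCategory) : set (set C) := [set pdom s | s in Il C].

Arguments J : clear implicits.

Section Semilattice.
Context {C : lcCategory}.
Implicit Types (s t : Il C) (e f : J C).

Lemma IlP s : Il C (val s). Proof. exact: set_valP. Qed.
Lemma JP e : J C (val e). Proof. exact: set_valP. Qed.

Definition Il_of (s : pbij C) (h : Il C s) : Il C := exist _ s (mem_set h).
Definition J_of (A : set C) (h : J C A) : J C := exist _ A (mem_set h).

Definition Ilinv s : Il C := Il_of (Il_pinv (IlP s)).
Definition Ilcomp s t : Il C := Il_of (Il_pcomp (IlP s) (IlP t)).

Lemma Il_pid (A : set C) : J C A -> Il C (pid A).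
Proof.
move=> [s Ils <-].
rewrite (_ : pid _ = pcomp (pinv s) s); first exact/Il_pcomp/Ils/Il_pinv.
apply/pbij_eq/seteqP; split=> -[x y] /=.
  by move=> [[z sxz] <-]; exists z.
by move=> [z /= sxz syz]; split; [exists z|exact: graph_inj sxz syz].
Qed.

Definition Jid e : Il C := Il_of (Il_pid (JP e)).

(* the idempotent $s^{-1}s$ *)
Definition sdom s : J C := J_of (imageP (@pdom C) (IlP s)).

Lemma J_ppre s e : J C (ppre (val s) (val e)).
Proof.
exists (pcomp (pid (val e)) (val s)); first exact/Il_pcomp/IlP/Il_pid/JP.
apply/seteqP; split=> x.
  by move=> [y [z /= sxz [ez _]]]; exists z.
by move=> [y sxy ey]; exists y, y.
Qed.

(* the idempotent $s^{-1}es$ *)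
Definition Jpre s e : J C := J_of (J_ppre s e).

Lemma J_setI e f : J C (val e `&` val f).
Proof.
rewrite (_ : _ `&` _ = ppre (val (Jid e)) (val f)); first exact: J_ppre.
apply/seteqP; split=> x /=; first by move=> [ex fx]; exists x.
by move=> [y [/= ex <-] fy].
Qed.

Definition Jcap e f : J C := J_of (J_setI e f).

Lemma J_eq e f : val e = val f -> e = f.
Proof. exact: val_inj. Qed.

End Semilattice.

(* Constructible differences $e\setminus\bigcup_i f_i$; $n = 0$ is allowed. *)
Definition is_diff (C : lcCategory) (n : nat) (e : J C) (f : 'I_n -> J C)
    (eps : set C) :=
  (forall i, val (f i) `<=` val e) /\
  eps = val e `\` \bigcup_i val (f i).

Definition Jbar (C : lcCategory) : set (set C) :=
  [set eps | exists n e (f : 'I_n -> J C), is_diff e f eps].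

Arguments Jbar : clear implicits.

(* [{ptws _ -> _}] carries the topology of pointwise convergence, and [Jhat C],
   used as a type, the induced topology. *)
Definition Jhat (C : lcCategory) : set {ptws J C -> bool} :=
  [set chi : J C -> bool | [/\ exists e, chi e,
                 forall e f, chi (Jcap e f) = chi e && chi f &
                 forall e, val e = set0 -> chi e = false]].

Arguments Jhat : clear implicits.

Section Characters.
Context {C : lcCategory}.
Implicit Types (s t : Il C) (e f : J C) (chi psi : Jhat C).

Definition ev chi e : bool := (val chi : J C -> bool) e.

Lemma JhatP chi : Jhat C (val chi). Proof. exact: set_valP. Qed.

Lemma ev_ex chi : exists e, ev chi e. Proof. by case: (JhatP chi). Qed.

Lemma ev_cap chi e f : ev chi (Jcap e f) = ev chi e && ev chi f.
Proof. by case: (JhatP chi) => _ + _; apply. Qed.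

Lemma ev_set0 chi e : val e = set0 -> ev chi e = false.
Proof. by case: (JhatP chi) => _ _; apply. Qed.

Lemma ev_sub chi e f : val e `<=` val f -> ev chi e -> ev chi f.
Proof.
move=> ef che; have := ev_cap chi e f.
rewrite (_ : Jcap e f = e); first by rewrite che.
by apply: J_eq; apply/seteqP; split=> x /= => [[]//|ex]; split=> //; exact: ef.
Qed.

Lemma char_eq chi psi : (forall e, ev chi e = ev psi e) -> chi = psi.
Proof. by move=> h; apply/val_inj/funext. Qed.

(* $(s.\chi)(e) = \chi(s^{-1}es)$ *)
Lemma act_subproof s chi : ev chi (sdom s) ->
  Jhat C (fun e => ev chi (Jpre s e)).
Proof.
move=> chs; split.
- exists (sdom (Ilinv s)); apply: ev_sub chs => x [y sxy].
  by exists y => //; exists x.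
- move=> e f; rewrite -ev_cap; congr ev; apply: J_eq; apply/seteqP; split=> x.
    by move=> [y sxy [ey fy]]; split; exists y.
  move=> [[y sxy ey] [z sxz fz]]; exists y => //; split => //=.
  by rewrite (graph_fun sxy sxz).
- move=> e e0; apply: ev_set0; apply/seteqP; split=> x // [y _].
  by rewrite [X in X y]e0.
Qed.

Definition act s chi (h : ev chi (sdom s)) : Jhat C :=
  exist (fun x => x \in Jhat C) _ (mem_set (act_subproof h)).

Lemma ev_act s chi (h : ev chi (sdom s)) e : ev (act h) e = ev chi (Jpre s e).
Proof. by []. Qed.

End Characters.

Definition Omega (C : lcCategory) : set (Jhat C) :=
  [set chi | forall n (e : J C) (f : 'I_n -> J C),
     val e = \bigcup_i val (f i) -> ev chi e -> exists i, ev chi (f i)].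
Arguments Omega : clear implicits.

Definition Omega_max (C : lcCategory) : set (Jhat C) :=
  [set chi | forall psi : Jhat C,
     [set e | ev chi e] `<=` [set e | ev psi e] ->
     [set e | ev psi e] = [set e | ev chi e]].
Arguments Omega_max : clear implicits.

(* The closure is taken in [Jhat C], in which [Omega C] is closed
   ([closed_Omega]). *)
Definition bOmega (C : lcCategory) : set (Jhat C) := closure (Omega_max C).
Arguments bOmega : clear implicits.

(* $\chi(\varepsilon) = 1$; see [evbarE] for the independence, when $\chi$ is in
   [Omega C], of the presentation of $\varepsilon$. *)
Definition evbar (C : lcCategory) (chi : Jhat C) (eps : set C) : Prop :=
  exists n e (f : 'I_n -> J C),
    [/\ is_diff e f eps, ev chi e & forall i, ~~ ev chi (f i)].

Lemma evbar_Jbar (C : lcCategory) (chi : Jhat C) eps :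
  evbar chi eps -> Jbar C eps.
Proof. by move=> [n [e [f [h _ _]]]]; exists n, e, f. Qed.

Section Omega.
Context {C : lcCategory}.
Implicit Types (s t : Il C) (e f : J C) (chi psi : Jhat C).

Lemma Omega_sub chi n e (f : 'I_n -> J C) : Omega C chi ->
  val e `<=` \bigcup_i val (f i) -> ev chi e -> exists i, ev chi (f i).
Proof.
move=> Ochi ef che; have [|i] := Ochi n e (fun i => Jcap e (f i)) _ che.
  apply/seteqP; split=> x; last by move=> [i _ []].
  by move=> ex; have [i _ fx] := ef x ex; exists i.
by rewrite ev_cap => /andP[_ chf]; exists i.
Qed.

Lemma Omega_diff chi n e (f : 'I_n -> J C) g : Omega C chi ->
  val e `\` \bigcup_i val (f i) `<=` val g ->
  ev chi e -> (forall i, ~~ ev chi (f i)) -> ev chi g.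
Proof.
move=> Ochi efg che chf.
have [|i] := @Omega_sub chi n.+1 e (fun i => oapp f g (unlift ord0 i)) Ochi
  _ che.
  move=> x ex; have [[i _ fx]|nfx] := pselect ((\bigcup_i val (f i)) x).
    by exists (lift ord0 i) => //; rewrite liftK.
  by exists ord0 => //; rewrite unlift_none; apply: efg.
case: (unliftP ord0 i) => [j|] _ /= => [fj|//].
by have := chf j; rewrite fj.
Qed.

Lemma evbarE chi n e (f : 'I_n -> J C) eps : Omega C chi ->
  is_diff e f eps ->
  evbar chi eps <-> ev chi e /\ forall i, ~~ ev chi (f i).
Proof.
move=> Ochi fe; split=> [[m [e' [f' [[fe' eps']]]]]|[che chf]]; last first.
  by exists n, e, f; split.
case: fe => fe epsE che' chf'; split.
  by apply: (Omega_diff Ochi _ che' chf'); rewrite -eps' epsE => x [].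
move=> i; apply/negP => chfi.
have che'f : ev chi (Jcap e' (f i)) by rewrite ev_cap che'.
have : ev chi (Jcap e' (f i)) -> exists j, ev chi (f' j).
  apply: Omega_sub => // x [e'x fx].
  apply: contrapT => nf'x; have : eps x by rewrite eps'.
  by rewrite epsE => -[_]; apply; exists i.
by move=> /(_ che'f)[j f'j]; have := chf' j; rewrite f'j.
Qed.

End Omega.

Section Invariance.
Context {C : lcCategory}.
Implicit Types (s t : Il C) (e f g : J C) (chi psi : Jhat C).

Lemma ev_near chi e : \forall psi \near chi, ev psi e = ev chi e.
Proof.
have vc : continuous (set_val : Jhat C -> {ptws J C -> bool}).
  exact: initial_continuous.
have := @proj_continuous (J C) (fun=> bool) e (val chi).
move=> /(continuous_comp (vc chi)).
by move=> /(_ [set ev chi e]); apply; exact: discrete_set1.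
Qed.

Lemma cvg_Jhat (X : topologicalType) (h : X -> Jhat C) x :
  (forall e, \forall y \near x, ev (h y) e = ev (h x) e) -> h y @[y --> x] --> h x.
Proof.
move=> hx; have : (set_val (h y) : {ptws J C -> bool}) @[y --> x] --> set_val (h x).
  apply/cvg_sup => e U [V [[W oW <-] /= Wx WU]].
  by apply: filterS (hx e) => y hy; apply: WU; rewrite /= [X in W X]hy.
move=> vcvg U [V [[W oW <-] Wx WU]]; apply: filterS WU _; apply: vcvg.
exact: open_nbhs_nbhs.
Qed.

Lemma act_ran s chi (h : ev chi (sdom s)) : ev (act h) (sdom (Ilinv s)).
Proof.
rewrite ev_act; apply: ev_sub h => x [y sxy].
by exists y => //; exists x.
Qed.

Lemma act_mono s chi psi (h : ev chi (sdom s)) (k : ev psi (sdom s)) :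
  [set e | ev chi e] `<=` [set e | ev psi e] ->
  [set e | ev (act h) e] `<=` [set e | ev (act k) e].
Proof. by move=> cp e /=; rewrite !ev_act; exact: cp. Qed.

Lemma Jpre_inv s e : val (Jpre s (Jpre (Ilinv s) e)) = val (Jcap (sdom s) e).
Proof.
apply/seteqP; split=> x /=.
  by move=> [y sxy [z szy ez]]; rewrite (graph_inj sxy szy); split=> //; exists y.
by move=> [[y sxy] ex]; exists y => //; exists x.
Qed.

Lemma actK s chi (h : ev chi (sdom s)) (k : ev (act h) (sdom (Ilinv s))) :
  act k = chi.
Proof. by apply: char_eq => e; rewrite !ev_act (J_eq (Jpre_inv s e)) ev_cap h. Qed.

Lemma IlinvK s : Ilinv (Ilinv s) = s.
Proof. by apply/val_inj/pbij_eq/funext; case. Qed.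

Lemma actVK s psi (k : ev psi (sdom (Ilinv s))) (h : ev (act k) (sdom s)) :
  act h = psi.
Proof.
apply: char_eq => e; have := J_eq (Jpre_inv (Ilinv s) e).
by rewrite IlinvK !ev_act => ->; rewrite ev_cap k.
Qed.

Lemma Omega_act s chi (h : ev chi (sdom s)) : Omega C chi -> Omega C (act h).
Proof.
move=> Ochi n e f ef; rewrite ev_act; apply: Omega_sub => // x [y sxy].
by rewrite ef => -[i _ fy]; exists i => //; exists y.
Qed.

Lemma Omega_max_act s chi (h : ev chi (sdom s)) :
  Omega_max C chi -> Omega_max C (act h).
Proof.
move=> mchi psi hpsi; apply/seteqP; split=> //.
have k : ev psi (sdom (Ilinv s)) by apply: hpsi; exact: act_ran.
have := mchi (act k).
rewrite -{1}(actK (act_ran h)) => /(_ (@act_mono _ _ _ (act_ran h) k hpsi)) /seteqP[kc _].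
have kk : ev (act k) (sdom s) by have := act_ran k; rewrite IlinvK.
have := @act_mono _ _ _ kk h kc.
by rewrite actVK.
Qed.

Lemma act_near s chi (h : ev chi (sdom s)) (U : set (Jhat C)) :
  nbhs (act h) U ->
  \forall psi \near chi, forall k : ev psi (sdom s), U (act k).
Proof.
pose f psi := if pselect (ev psi (sdom s)) is left k then act k else psi.
have fE psi (k : ev psi (sdom s)) : f psi = act k.
  by rewrite /f; case: pselect => // k'; rewrite (bool_irrelevance k k').
have : f psi @[psi --> chi] --> f chi.
  apply: cvg_Jhat => e; rewrite (fE _ h) ev_act.
  apply: filterS (filterI (ev_near chi (sdom s)) (ev_near chi (Jpre s e))).
  by move=> psi []; rewrite h => k <-; rewrite (fE _ k).
rewrite (fE _ h) => fcvg hU; have fU : nbhs chi (f @^-1` U) := fcvg _ hU.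
by apply: filterS fU => psi Uf k; move: Uf; rewrite /= (fE _ k).
Qed.

Lemma bOmega_act s chi (h : ev chi (sdom s)) :
  bOmega C chi -> bOmega C (act h).
Proof.
move=> bchi U /act_near/filterI /(_ (ev_near chi (sdom s))) /bchi[psi].
rewrite h => -[mpsi [+ k]] => /(_ k) Uk.
by exists (act k); split=> //; exact: Omega_max_act.
Qed.

Lemma ev_all chi n (P : 'I_n -> J C -> Prop) :
  (forall i g g', val g' `<=` val g -> P i g -> P i g') ->
  (forall i, exists2 g, ev chi g & P i g) ->
  exists2 g, ev chi g & forall i, P i g.
Proof.
elim: n P => [|n IH] P Psub exP.
  by have [g chg] := ev_ex chi; exists g => // -[].
have [g0 chg0 Pg0] := exP ord0.
have [|i|g chg Pg] := IH (fun i => P (lift ord0 i)).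
- by move=> i g g'; exact: Psub.
- exact: exP.
exists (Jcap g0 g); first by rewrite ev_cap chg0.
move=> i; case: (unliftP ord0 i) => [j|] ->.
  by apply: Psub (Pg j) => x [].
by apply: Psub Pg0 => x [].
Qed.

Lemma Omega_max_sub : Omega_max C `<=` Omega C.
Proof.
move=> chi mchi n e f ef che; apply: contrapT => nchf.
have sep i : exists2 g, ev chi g & val g `&` val (f i) = set0.
  apply: contrapT => nsep; apply: nchf; exists i.
  have meet g : ev chi g -> exists x, (val g `&` val (f i)) x.
    move=> chg; apply: contrapT => gf; apply: nsep; exists g => //.
    by apply/seteqP; split=> x // gfx; apply: gf; exists x.
  pose p (a : J C) : bool :=
    `[< exists2 g, ev chi g & val g `&` val (f i) `<=` val a >].
  have pJ : Jhat C p.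
    split.
    - by exists e; apply/asboolP; exists e => // x [].
    - move=> a b; apply/asboolP/andP.
        move=> [g chg gab]; split; apply/asboolP; exists g => // x.
          by move=> /gab[].
        by move=> /gab[].
      move=> [/asboolP[g chg ga] /asboolP[g' chg' gb]].
      exists (Jcap g g'); first by rewrite ev_cap chg.
      by move=> x [[gx g'x] fx]; split; [exact: ga|exact: gb].
    - move=> a a0; apply/asboolP => -[g /meet[x gx]] /(_ x gx).
      by rewrite [val a]a0.
  have := mchi (exist (fun x => x \in Jhat C) _ (mem_set pJ)).
  case/(_ _)/seteqP => [a cha|/(_ (f i)) pf _].
    by apply/asboolP; exists a => // x [].
  by apply: pf; apply/asboolP; exists e => // x [].
have [g chg gf] : exists2 g, ev chi g & forall i, val g `&` val (f i) = set0.
  apply: ev_all sep => i g g' gg' g0; apply/seteqP; split=> x // [g'x fx].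
  by have /seteqP[/(_ x) + _] := g0; apply; split=> //; exact: gg'.
have : ev chi (Jcap e g) by rewrite ev_cap che.
rewrite ev_set0 //; apply/seteqP; split=> x //= [].
by rewrite ef => -[i _ fx] gx; have /seteqP[/(_ x) + _] := gf i; apply.
Qed.

Lemma closed_Omega : closed (Omega C).
Proof.
move=> chi Ochi n e f ef che; apply: contrapT => nchf.
have nf i : ev chi (f i) = false by apply/negP => fi; apply: nchf; exists i.
have nbf i : nbhs chi [set psi | ev psi (f i) = false].
  by have := ev_near chi (f i); rewrite nf.
have := Ochi _ (filterI (filter_forall (F := nbhs chi) _ nbf) (ev_near chi e)).
move=> [psi [Opsi [npsi]]]; rewrite che => pe.
by have [i] := Opsi n e f ef pe; rewrite npsi.
Qed.

Lemma bOmega_sub : bOmega C `<=` Omega C.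
Proof.
rewrite /bOmega closureE; apply: smallest_sub; first exact: closed_Omega.
exact: Omega_max_sub.
Qed.

End Invariance.

Record invSubset (C : lcCategory) := InvSubset {
  inv_set :> set (Jhat C);
  inv_subset : inv_set `<=` Omega C;
  inv_act : forall (s : Il C) (chi : Jhat C) (h : ev chi (sdom s)),
    inv_set chi -> inv_set (act h) }.

Definition Omega_inv (C : lcCategory) : invSubset C :=
  InvSubset (@subset_refl _ (Omega C)) (@Omega_act C).

Definition bOmega_inv (C : lcCategory) : invSubset C :=
  InvSubset (@bOmega_sub C) (@bOmega_act C).

(* [gmul g h] is meaningful only when [gsrc g = grng h]; other values are
   unspecified. *)
Record topGroupoid := TopGroupoid {
  arrows :> topologicalType;
  units : topologicalType;
  gsrc : arrows -> units;
  grng : arrows -> units;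
  gunit : units -> arrows;
  ginv : arrows -> arrows;
  gmul : arrows -> arrows -> arrows;
  gsrc_unit : forall u, gsrc (gunit u) = u;
  grng_unit : forall u, grng (gunit u) = u;
  gsrc_mul : forall g h, gsrc g = grng h -> gsrc (gmul g h) = gsrc h;
  grng_mul : forall g h, gsrc g = grng h -> grng (gmul g h) = grng g;
  gmulA : forall g h k, gsrc g = grng h -> gsrc h = grng k ->
    gmul g (gmul h k) = gmul (gmul g h) k;
  gmul_unitr : forall g, gmul g (gunit (gsrc g)) = g;
  gmul_unitl : forall g, gmul (gunit (grng g)) g = g;
  gsrc_inv : forall g, gsrc (ginv g) = grng g;
  grng_inv : forall g, grng (ginv g) = gsrc g;
  gmulV : forall g, gmul g (ginv g) = gunit (grng g);
  gmulVl : forall g, gmul (ginv g) g = gunit (gsrc g);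
  gsrc_continuous : continuous gsrc;
  grng_continuous : continuous grng;
  gunit_continuous : continuous gunit;
  ginv_continuous : continuous ginv;
  gmul_continuous : {within [set p : arrows * arrows | gsrc p.1 = grng p.2],
    continuous (fun p : arrows * arrows => gmul p.1 p.2)} }.

Record topGroupoid_iso (G H : topGroupoid) (F : G -> H) : Prop :=
  TopGroupoidIso {
  iso_homeo : exists F' : H -> G,
    [/\ cancel F F', cancel F' F, continuous F & continuous F'];
  iso_composable : forall g h : G,
    gsrc (F g) = grng (F h) <-> gsrc g = grng h;
  iso_mul : forall g h : G,
    gsrc g = grng h -> F (gmul g h) = gmul (F g) (F h) }.

(* The two germ relations differ only in the sets on which the partial
   bijections have to agree at $\chi$: the $e \in \mathcal J$ with
   $\chi(e) = 1$ ([famJ]), or the $\varepsilon \in \bar{\mathcal J}$ with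
   $\chi(\varepsilon) = 1$ ([famJbar]).  A [germFam] is such a choice of sets,
   with the properties that make the germs a topological groupoid. *)
Record germFam (C : lcCategory) := GermFam {
  fam :> Jhat C -> set (set C);
  fam_ex : forall chi, exists A, fam chi A;
  fam_setI : forall chi A B, fam chi A -> fam chi B -> fam chi (A `&` B);
  fam_pre : forall (s : Il C) chi (h : ev chi (sdom s)) A,
    fam (act h) A -> fam chi (ppre (val s) A);
  fam_near : forall chi A, fam chi A -> \forall psi \near chi, fam psi A;
  fam_ev : forall chi A e f, Omega C chi -> fam chi A ->
    val e `&` A `<=` val f -> ev chi e -> ev chi f }.

Section Families.
Context {C : lcCategory}.
Implicit Types (s t : Il C) (e f : J C) (chi psi : Jhat C) (A B : set C).

Let famJ_set chi : set (set C) := [set A | exists2 e : J C, ev chi e & A = val e].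

Let famJ_ex chi : exists A, famJ_set chi A.
Proof. by have [e che] := ev_ex chi; exists (val e), e. Qed.

Let famJ_setI chi A B : famJ_set chi A -> famJ_set chi B ->
  famJ_set chi (A `&` B).
Proof.
move=> [e che ->] [f chf ->].
by exists (Jcap e f) => //; rewrite ev_cap che.
Qed.

Let famJ_pre s chi (h : ev chi (sdom s)) A :
  famJ_set (act h) A -> famJ_set chi (ppre (val s) A).
Proof. by move=> [e che ->]; exists (Jpre s e). Qed.

Let famJ_near chi A : famJ_set chi A -> \forall psi \near chi, famJ_set psi A.
Proof.
move=> [e che ->]; apply: filterS (ev_near chi e) => psi.
by rewrite che => pe; exists e.
Qed.

Let famJ_ev chi A e f : Omega C chi -> famJ_set chi A ->
  val e `&` A `<=` val f -> ev chi e -> ev chi f.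
Proof.
move=> _ [g chg ->] egf che.
by apply: (ev_sub (e := Jcap e g)) => //; rewrite ev_cap che.
Qed.

Definition famJ : germFam C :=
  GermFam famJ_ex famJ_setI famJ_pre famJ_near famJ_ev.

Let famJbar_ex chi : exists A, evbar chi A.
Proof.
have [e che] := ev_ex chi.
exists (val e), 0%N, e, (fun=> e); split=> //; last by case.
split=> [[]//|]; apply/seteqP; split=> x; last by case.
by move=> ex; split=> // -[[]].
Qed.

Let famJbar_setI chi A B : evbar chi A -> evbar chi B -> evbar chi (A `&` B).
Proof.
move=> [n [e [f [[fe ->] che chf]]]] [m [e' [f' [[fe' ->] che' chf']]]].
exists (n + m)%N, (Jcap e e'), (fun i : 'I_(n + m) => match fintype.split i with
  | inl j => Jcap (f j) e' | inr j => Jcap e (f' j) end).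
split; [split| |].
- move=> i; case: (fintype.split i) => j x [] /=.
    by move=> /fe.
  by move=> ex /fe'.
- apply/seteqP; split=> x.
    move=> [[ex nf] [e'x nf']]; split=> //= -[i _].
    case: (fintype.split i) => j [fx f'x]; first by apply: nf; exists j.
    by apply: nf'; exists j.
  move=> [[ex e'x] nff']; split; split=> // -[j _ fx]; apply: nff'.
    by exists (lshift m j) => //=; have /= -> := unsplitK (inl j).
  by exists (rshift n j) => //=; have /= -> := unsplitK (inr j).
- by rewrite ev_cap che.
- move=> i; case: (fintype.split i) => j; rewrite ev_cap.
    by rewrite negb_and chf.
  by rewrite negb_and chf' orbT.
Qed.

Let famJbar_pre s chi (h : ev chi (sdom s)) A :
  evbar (act h) A -> evbar chi (ppre (val s) A).
Proof.
move=> [n [e [f [[fe ->] che chf]]]].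
exists n, (Jpre s e), (fun i => Jpre s (f i)); split=> //; split.
  by move=> i x [y sxy /fe ey]; exists y.
apply/seteqP; split=> x.
  move=> [y sxy [ey nfy]]; split; first by exists y.
  by move=> [i _ [z sxz fz]]; apply: nfy; exists i => //; rewrite (graph_fun sxy sxz).
move=> [[y sxy ey] nf]; exists y => //; split=> // -[i _ fy].
by apply: nf; exists i => //; exists y.
Qed.

Let famJbar_near chi A : evbar chi A -> \forall psi \near chi, evbar psi A.
Proof.
move=> [n [e [f [fe che chf]]]].
have nbf i : nbhs chi [set psi | ~~ ev psi (f i)].
  by apply: filterS (ev_near chi (f i)) => psi /= ->.
apply: filterS (filterI (filter_forall (F := nbhs chi) _ nbf) (ev_near chi e)).
by move=> psi [psf]; rewrite che => pse; exists n, e, f.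
Qed.

Let famJbar_ev chi A e f : Omega C chi -> evbar chi A ->
  val e `&` A `<=` val f -> ev chi e -> ev chi f.
Proof.
move=> Ochi [n [e' [f' [[fe' ->] che' chf']]]] sub che.
apply: (@Omega_diff C chi n (Jcap e e') f' f) => //; last by rewrite ev_cap che.
by move=> x [[ex e'x] nf]; apply: sub; split.
Qed.

Definition famJbar : germFam C :=
  GermFam famJbar_ex famJbar_setI famJbar_pre famJbar_near famJbar_ev.

End Families.
Arguments famJ : clear implicits.
Arguments famJbar : clear implicits.

(* The pairs $(s, \chi)$ with $\chi(s^{-1}s) = 1$, topologized as a subspace of
   (discrete [Il C]) x [Y]; the germs carry the quotient topology, described
   in the usual way by [germ_slice_open], [germ_slice_homeo]. *)
Definition pregerm (C : lcCategory) (Y : invSubset C) :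
    set (discrete_topology (Il C) * Y) :=
  [set p | ev (val p.2) (sdom p.1)].
Arguments pregerm {C} Y.

Section Pregerms.
Context {C : lcCategory} {Y : invSubset C}.
Implicit Types (s t : Il C) (p q : pregerm Y) (chi psi : Y).

Definition pg_elt p : Il C := (val p).1.
Definition pg_src p : Y := (val p).2.

Lemma pgP p : ev (val (pg_src p)) (sdom (pg_elt p)).
Proof. exact: set_valP p. Qed.

Definition mkpg s chi (h : ev (val chi) (sdom s)) : pregerm Y :=
  exist (fun x => x \in pregerm Y) (s, chi) (mem_set h).

Definition pg_rng p : Y :=
  exist (fun x => x \in inv_set Y) (act (pgP p))
    (mem_set (inv_act (pgP p) (set_valP (pg_src p)))).

Lemma pg_eq p q : pg_elt p = pg_elt q -> pg_src p = pg_src q -> p = q.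
Proof.
move=> epq spq; apply: val_inj; move: epq spq; rewrite /pg_elt /pg_src.
by case: (val p) (val q) => ? ? [? ?] /= -> ->.
Qed.

Lemma ev_rng p e : ev (val (pg_rng p)) e = ev (val (pg_src p)) (Jpre (pg_elt p) e).
Proof. by []. Qed.

Lemma Y_eq chi psi : (forall e, ev (val chi) e = ev (val psi) e) -> chi = psi.
Proof. by move=> h; apply/val_inj/char_eq. Qed.

Lemma pg_mul_subproof p q : pg_src p = pg_rng q ->
  ev (val (pg_src q)) (sdom (Ilcomp (pg_elt p) (pg_elt q))).
Proof.
move=> pq; have := pgP p; rewrite pq ev_rng; apply: ev_sub.
by move=> x [y qxy [z pyz]]; exists z, y.
Qed.

(* $(s, t.\chi)(t, \chi) = (st, \chi)$; the value is [q] on the pairs that are not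
   composable *)
Definition pg_mul p q : pregerm Y :=
  if pselect (pg_src p = pg_rng q) is left h then mkpg (pg_mul_subproof h)
  else q.

Lemma pg_mul_elt p q : pg_src p = pg_rng q ->
  pg_elt (pg_mul p q) = Ilcomp (pg_elt p) (pg_elt q).
Proof. by rewrite /pg_mul; case: pselect. Qed.

Lemma pg_mul_src p q : pg_src (pg_mul p q) = pg_src q.
Proof. by rewrite /pg_mul; case: pselect. Qed.

Definition pg_inv p : pregerm Y :=
  @mkpg (Ilinv (pg_elt p)) (pg_rng p) (act_ran (pgP p)).

Definition pg_unit chi : pregerm Y :=
  let: exist e he := cid (ev_ex (val chi)) in
  @mkpg (Jid e) chi (ev_sub (e := e) (f := sdom (Jid e))
    (fun x ex => ex_intro _ x (conj ex erefl)) he).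

Lemma pg_mul_rng p q : pg_src p = pg_rng q -> pg_rng (pg_mul p q) = pg_rng p.
Proof.
move=> pq; apply: Y_eq => e; rewrite !ev_rng pg_mul_src (pg_mul_elt pq) pq ev_rng.
congr ev; apply: J_eq; apply/seteqP; split=> x.
  by move=> [y [z qxz pzy] ey]; exists z => //; exists y.
by move=> [z qxz [y pzy ey]]; exists y => //; exists z.
Qed.

Lemma pg_inv_rng p : pg_rng (pg_inv p) = pg_src p.
Proof. by apply/val_inj/actK. Qed.

Lemma pg_unitE chi : exists2 e, ev (val chi) e &
  pg_elt (pg_unit chi) = Jid e /\ pg_src (pg_unit chi) = chi.
Proof. by rewrite /pg_unit; case: cid => e he; exists e. Qed.

Lemma pg_unit_rng chi : pg_rng (pg_unit chi) = chi.
Proof.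
have [e che [ue us]] := pg_unitE chi; apply: Y_eq => f; rewrite ev_rng us ue.
rewrite (_ : Jpre _ _ = Jcap e f) ?ev_cap ?che //.
apply: J_eq; apply/seteqP; split=> x /=.
  by move=> [y [/= ex <-] fx].
by move=> [ex fx]; exists x.
Qed.

Lemma pg_near p (U : set Y) : nbhs (pg_src p) U ->
  \forall q \near p, pg_elt q = pg_elt p /\ U (pg_src q).
Proof.
move=> Up; have vc : continuous (set_val : pregerm Y -> _).
  exact: initial_continuous.
have pU : nbhs (val p) ([set pg_elt p] `*` U).
  by exists ([set pg_elt p], U) => //; split=> //; exact: discrete_set1.
have : nbhs p (set_val @^-1` ([set pg_elt p] `*` U)) := vc p _ pU.
by apply: filterS => q [].
Qed.

Lemma pg_slice p (W : set (pregerm Y)) : nbhs p W ->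
  \forall psi \near pg_src p, forall h : ev (val psi) (sdom (pg_elt p)),
    W (mkpg h).
Proof.
move=> [_ [[O oO <-] /= Op OW]].
have [[A B] /= [A1 B1] AB] : nbhs (val p) O by exact: open_nbhs_nbhs.
apply: filterS B1 => psi Bpsi h; apply: OW; apply: AB; split => //=.
exact: nbhs_singleton A1.
Qed.

Lemma Y_near chi e : \forall psi \near chi, ev (val psi) e = ev (val chi) e.
Proof.
have vc : continuous (set_val : Y -> _) by exact: initial_continuous.
exact: (vc chi) (ev_near (val chi) e).
Qed.

Lemma pg_slice_open (W : set (pregerm Y)) :
  (forall p, W p -> \forall psi \near pg_src p,
    forall h : ev (val psi) (sdom (pg_elt p)), W (mkpg h)) -> open W.
Proof.
move=> h; rewrite openE => p /h /pg_near; apply: filterS => q [qp].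
have hq : ev (val (pg_src q)) (sdom (pg_elt p)) by rewrite -qp; exact: pgP.
by move=> /(_ hq); rewrite (_ : mkpg hq = q) //; exact: pg_eq.
Qed.

Lemma cvg_Y (X : topologicalType) (h : X -> Y) x :
  (forall e, \forall y \near x, ev (val (h y)) e = ev (val (h x)) e) ->
  h y @[y --> x] --> h x.
Proof.
move=> /(@cvg_Jhat _ _ (val \o h)) vcvg U [V [[W oW <-] Wx WU]].
by apply: filterS WU _; apply: vcvg; exact: open_nbhs_nbhs.
Qed.

Lemma pg_src_continuous : continuous pg_src.
Proof. by move=> p U /pg_near; apply: filterS => q []. Qed.

Lemma pg_rng_continuous : continuous pg_rng.
Proof.
move=> p; apply: cvg_Y => e.
apply: filterS (pg_near (Y_near (pg_src p) (Jpre (pg_elt p) e))) => q [qp].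
by rewrite !ev_rng qp.
Qed.

Lemma pg_inv_continuous : continuous pg_inv.
Proof.
move=> p U /pg_slice Up.
have Uq : nbhs p (pg_rng @^-1` _) := pg_rng_continuous Up.
apply: (filterS _ (filterI Uq (pg_near (filterT : nbhs (pg_src p) setT)))).
move=> q [Wq [qp _]].
have h : ev (val (pg_rng q)) (sdom (Ilinv (pg_elt p))).
  by rewrite -qp; exact: act_ran (pgP q).
have := Wq h; rewrite (_ : mkpg h = pg_inv q) //; apply: pg_eq => //.
by apply: val_inj; rewrite /= -/(pg_elt _) qp.
Qed.

End Pregerms.

Section Germs.
Local Open Scope quotient_scope.
Context {C : lcCategory} (F : germFam C) (Y : invSubset C).
Implicit Types (s t : Il C) (p q : pregerm Y) (chi psi : Y).

Definition germ_rel p q : bool :=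
  `[< pg_src p = pg_src q /\ exists2 A, F (val (pg_src p)) A &
      prestr (val (pg_elt p)) A = prestr (val (pg_elt q)) A >].

Lemma germ_relP p q : reflect (pg_src p = pg_src q /\
    exists2 A, F (val (pg_src p)) A &
    forall x y, A x -> val (pg_elt p) (x, y) <-> val (pg_elt q) (x, y))
  (germ_rel p q).
Proof.
apply: (iffP (asboolP _)) => -[src [A FA pq]]; split=> //; exists A => //.
  exact/prestrP.
exact/prestrP.
Qed.

Lemma germ_rel_refl : reflexive germ_rel.
Proof.
by move=> p; apply/asboolP; split=> //; have [A FA] := fam_ex F (val (pg_src p));
  exists A.
Qed.

Lemma germ_rel_sym : symmetric germ_rel.
Proof.
suff h p q : germ_rel p q -> germ_rel q p by move=> p q; apply/idP/idP; exact: h.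
by move=> /asboolP[pq [A FA e]]; apply/asboolP; split=> //; exists A; rewrite -?pq.
Qed.

Lemma germ_rel_trans : transitive germ_rel.
Proof.
move=> q p r /germ_relP[pq [A FA ApqE]] /germ_relP[qr [B FB BqrE]].
apply/germ_relP; split; first by rewrite pq.
exists (A `&` B); first by apply: fam_setI => //; rewrite pq.
by move=> x y [Ax Bx]; rewrite (ApqE x y Ax); exact: BqrE.
Qed.

Canonical germ_equiv :=
  EquivRel germ_rel germ_rel_refl germ_rel_sym germ_rel_trans.

Definition germs : topologicalType := quotient_topology {eq_quot germ_equiv}.

Definition germ p : germs := \pi_({eq_quot germ_equiv}) p.

Definition germ_repr (g : germs) : pregerm Y :=
  repr (g : {eq_quot germ_equiv}).

Lemma germ_reprK g : germ (germ_repr g) = g.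
Proof. exact: reprK. Qed.

Lemma germP p q : germ p = germ q <-> germ_rel p q.
Proof. by split=> [/eqmodP|pq]//; apply/eqmodP. Qed.

Lemma repr_germ p : germ_rel (germ_repr (germ p)) p.
Proof. by apply/germP; rewrite germ_reprK. Qed.

Lemma germ_continuous : continuous germ.
Proof. exact: pi_continuous. Qed.

Lemma germ_rng p q : germ_rel p q -> pg_rng p = pg_rng q.
Proof.
suff h p' q' e : germ_rel p' q' -> ev (val (pg_rng p')) e -> ev (val (pg_rng q')) e.
  move=> pq; apply: Y_eq => e; apply/idP/idP; apply: h => //.
  by rewrite germ_rel_sym.
move=> /germ_relP[src [A FA pq]]; rewrite !ev_rng -src.
apply: fam_ev FA _; first exact: inv_subset (set_valP (pg_src p')).
by move=> x [[y pxy ey] Ax]; exists y => //; exact/(pq x y Ax).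
Qed.

Lemma germ_mul p p' q q' : germ_rel p p' -> germ_rel q q' ->
  pg_src p = pg_rng q -> germ_rel (pg_mul p q) (pg_mul p' q').
Proof.
move=> pp' qq' pq.
have pq' : pg_src p' = pg_rng q'.
  by rewrite -(germ_rng qq') -pq; have /germ_relP[] := pp'.
have /germ_relP[_ [A FA Ap]] := pp'.
have /germ_relP[sq [B FB Bq]] := qq'.
apply/germ_relP; rewrite !pg_mul_src !pg_mul_elt //; split=> //.
exists (B `&` ppre (val (pg_elt q)) A).
  apply: fam_setI => //; apply: (fam_pre (h := pgP q)).
  by move: FA; rewrite pq.
move=> x y [Bx [z qxz Az]]; split=> -[w /= qw pw].
  have wz := graph_fun qw qxz; rewrite wz in qw pw.
  by exists z => /=; [exact/(Bq x z Bx)|exact/(Ap z y Az)].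
have qw' : val (pg_elt q) (x, w) by exact/(Bq x w Bx).
have wz := graph_fun qw' qxz; rewrite wz in qw' pw.
by exists z => //=; exact/(Ap z y Az).
Qed.

Lemma germ_inv p q : germ_rel p q -> germ_rel (pg_inv p) (pg_inv q).
Proof.
move=> pq; have /germ_relP[src [A FA Apq]] := pq.
apply/germ_relP; split; first exact: germ_rng.
exists (ppre (val (Ilinv (pg_elt p))) A).
  by apply: (fam_pre (h := act_ran (pgP p))); rewrite actK.
move=> x y [z pzx Az]; split=> /= [pyx|qyx].
  have yz := graph_inj pyx pzx; rewrite yz.
  exact/(Apq z x Az).
have qzx : val (pg_elt q) (z, x) by exact/(Apq z x Az).
by rewrite (graph_inj qyx qzx).
Qed.

Definition gm_src (g : germs) : Y := pg_src (germ_repr g).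
Definition gm_rng (g : germs) : Y := pg_rng (germ_repr g).
Definition gm_unit chi : germs := germ (pg_unit chi).
Definition gm_inv (g : germs) : germs := germ (pg_inv (germ_repr g)).
Definition gm_mul (g h : germs) : germs :=
  germ (pg_mul (germ_repr g) (germ_repr h)).

Lemma gm_srcE p : gm_src (germ p) = pg_src p.
Proof. by have /germ_relP[] := repr_germ p. Qed.

Lemma gm_rngE p : gm_rng (germ p) = pg_rng p.
Proof. exact/germ_rng/repr_germ. Qed.

Lemma gm_invE p : gm_inv (germ p) = germ (pg_inv p).
Proof. exact/germP/germ_inv/repr_germ. Qed.

Lemma gm_mulE p q : pg_src p = pg_rng q ->
  gm_mul (germ p) (germ q) = germ (pg_mul p q).
Proof.
move=> pq; apply/germP; apply: germ_mul; [exact: repr_germ..|].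
by rewrite -/(gm_src _) -/(gm_rng _) gm_srcE gm_rngE.
Qed.

Lemma germ_ind (P : germs -> Prop) : (forall p, P (germ p)) -> forall g, P g.
Proof. by move=> h g; rewrite -(germ_reprK g). Qed.

Lemma gm_src_mul g h : gm_src g = gm_rng h -> gm_src (gm_mul g h) = gm_src h.
Proof. by move=> _; rewrite gm_srcE pg_mul_src. Qed.

Lemma gm_rng_mul g h : gm_src g = gm_rng h -> gm_rng (gm_mul g h) = gm_rng g.
Proof. by move=> gh; rewrite gm_rngE pg_mul_rng. Qed.

Lemma gm_src_unit chi : gm_src (gm_unit chi) = chi.
Proof. by rewrite gm_srcE; have [e _ [_ ->]] := pg_unitE chi. Qed.

Lemma gm_rng_unit chi : gm_rng (gm_unit chi) = chi.
Proof. by rewrite gm_rngE pg_unit_rng. Qed.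

Lemma gm_mulA g h k : gm_src g = gm_rng h -> gm_src h = gm_rng k ->
  gm_mul g (gm_mul h k) = gm_mul (gm_mul g h) k.
Proof.
elim/germ_ind: g => p; elim/germ_ind: h => q; elim/germ_ind: k => r.
rewrite !gm_srcE !gm_rngE => pq qr.
have pqr : pg_src p = pg_rng (pg_mul q r) by rewrite pg_mul_rng.
have pqr' : pg_src (pg_mul p q) = pg_rng r by rewrite pg_mul_src.
rewrite !gm_mulE //; congr germ; apply: pg_eq; last by rewrite !pg_mul_src.
rewrite !pg_mul_elt //; apply/val_inj/pbij_eq/seteqP; split=> -[x y] /=.
  by move=> [z /= [w /= rxw qwz] pzy]; exists w => //=; exists z.
by move=> [w /= rxw [z /= qwz pzy]]; exists z => //=; exists w.
Qed.

Lemma fam_dom chi (e : J C) : ev (val chi) e ->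
  exists2 A, F (val chi) A & A `<=` val e.
Proof.
move=> che; pose s := Jid e.
have h : ev (val chi) (sdom s).
  by apply: ev_sub che => x ex; exists x.
have [A FA] := fam_ex F (act h).
exists (ppre (val s) A); first exact: fam_pre FA.
by move=> x [y [ex _] _].
Qed.

Lemma germ_same p q (e : J C) : pg_src p = pg_src q -> ev (val (pg_src p)) e ->
  (forall x y, val e x -> val (pg_elt p) (x, y) <-> val (pg_elt q) (x, y)) ->
  germ p = germ q.
Proof.
move=> src pe pq; apply/germP/germ_relP; split=> //.
by have [A FA Ae] := fam_dom pe; exists A => // x y /Ae; exact: pq.
Qed.

Lemma gm_mul_unitr g : gm_mul g (gm_unit (gm_src g)) = g.
Proof.
elim/germ_ind: g => p; rewrite gm_srcE gm_mulE ?pg_unit_rng //.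
have [e che [ue us]] := pg_unitE (pg_src p).
apply: (@germ_same _ _ e); rewrite ?pg_mul_src ?us //.
move=> x y ex; rewrite pg_mul_elt ?pg_unit_rng // ue; split=> /=.
  by move=> [z /= [_ <-]].
by move=> pxy; exists x.
Qed.

Lemma gm_mul_unitl g : gm_mul (gm_unit (gm_rng g)) g = g.
Proof.
elim/germ_ind: g => p; have [e che [ue us]] := pg_unitE (pg_rng p).
rewrite gm_rngE gm_mulE //.
apply: (@germ_same _ _ (Jpre (pg_elt p) e)); rewrite ?pg_mul_src //.
move=> x y [z pxz ez]; rewrite pg_mul_elt // ue; split=> /=.
  by move=> [w /= pxw [_ <-]].
move=> pxy; exists y => //=; split=> //.
by rewrite (graph_fun pxy pxz).
Qed.

Lemma gm_src_inv g : gm_src (gm_inv g) = gm_rng g.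
Proof. by rewrite gm_srcE. Qed.

Lemma gm_rng_inv g : gm_rng (gm_inv g) = gm_src g.
Proof. by rewrite gm_rngE pg_inv_rng. Qed.

Lemma gm_mulV g : gm_mul g (gm_inv g) = gm_unit (gm_rng g).
Proof.
elim/germ_ind: g => p; rewrite gm_invE gm_rngE gm_mulE ?pg_inv_rng //.
have [e che [ue us]] := pg_unitE (pg_rng p).
apply: (@germ_same _ _ (Jcap e (sdom (Ilinv (pg_elt p))))).
- by rewrite pg_mul_src us.
- by rewrite pg_mul_src ev_cap; apply/andP; split=> //; exact: act_ran (pgP p).
move=> x y [ex [z pzx]]; rewrite pg_mul_elt ?pg_inv_rng // ue; split=> /=.
  by move=> [w /= pwx pwy]; split=> //; exact: graph_fun pwx pwy.
by move=> [_ <-]; exists z.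
Qed.

Lemma gm_mulVl g : gm_mul (gm_inv g) g = gm_unit (gm_src g).
Proof.
elim/germ_ind: g => p; rewrite gm_invE gm_srcE gm_mulE //.
have [e che [ue us]] := pg_unitE (pg_src p).
apply: (@germ_same _ _ (Jcap e (sdom (pg_elt p)))).
- by rewrite pg_mul_src us.
- by rewrite pg_mul_src ev_cap che; exact: pgP.
move=> x y [ex [z pxz]]; rewrite pg_mul_elt // ue; split=> /=.
  by move=> [w /= pxw pyw]; split=> //; exact: graph_inj pxw pyw.
by move=> [_ <-]; exists z.
Qed.

Lemma germ_open (W : set (pregerm Y)) : open W -> open (germ @` W).
Proof.
move=> oW; rewrite /open /= /quotient_open; apply: pg_slice_open => p.
move=> [q Wq /germP/germ_relP[src [A FA qp]]].
have := pg_slice (open_nbhs_nbhs (conj oW Wq)).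
rewrite src => Wq'; rewrite src in FA.
have vc : continuous (set_val : Y -> _) by exact: initial_continuous.
have FA' : \forall psi \near pg_src p, F (val psi) A.
  exact: (vc (pg_src p) _ (fam_near FA)).
have qsp : ev (val (pg_src p)) (sdom (pg_elt q)) by rewrite -src pgP.
have dq := Y_near (pg_src p) (sdom (pg_elt q)).
apply: filterS (filterI (filterI Wq' FA') dq) => psi [[Wpsi Fpsi]] + h.
rewrite qsp => dpsi.
exists (mkpg dpsi); first exact: Wpsi.
by apply/germP/germ_relP; split=> //; exists A.
Qed.

(* the image of $\{s\}\times\{\chi\in Y : \chi(s^{-1}s) = 1\}$ *)
Definition germ_slice s : set germs := germ @` [set p | pg_elt p = s].

Lemma germ_slice_open s : open (germ_slice s).
Proof.
apply: germ_open; apply: pg_slice_open => p /= ps.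
by apply: filterE => psi h; rewrite -ps.
Qed.

Lemma germ_near p (U : set germs) : nbhs (germ p) U ->
  \forall psi \near pg_src p, forall h : ev (val psi) (sdom (pg_elt p)),
    U (germ (mkpg h)).
Proof.
move=> Up; have pU : nbhs p (germ @^-1` U) := germ_continuous Up.
exact: pg_slice pU.
Qed.

Lemma gm_src_continuous : continuous gm_src.
Proof.
apply/quotient_continuous; rewrite (_ : _ \o _ = pg_src).
  exact: pg_src_continuous.
by apply/funext => p; exact: gm_srcE.
Qed.

Lemma gm_rng_continuous : continuous gm_rng.
Proof.
apply/quotient_continuous; rewrite (_ : _ \o _ = pg_rng).
  exact: pg_rng_continuous.
by apply/funext => p; exact: gm_rngE.
Qed.

Lemma gm_inv_continuous : continuous gm_inv.
Proof.
apply/quotient_continuous; rewrite (_ : _ \o _ = germ \o pg_inv).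
  by move=> p; apply: continuous_comp; [exact: pg_inv_continuous|
    exact: germ_continuous].
by apply/funext => p; exact: gm_invE.
Qed.

Lemma gm_unit_continuous : continuous gm_unit.
Proof.
move=> chi U; rewrite /gm_unit; have [e che [ue us]] := pg_unitE chi.
move=> /germ_near; rewrite us ue => nU.
apply: filterS (filterI nU (Y_near chi e)) => psi [Upsi].
rewrite che => pe; have h : ev (val psi) (sdom (Jid e)).
  by apply: ev_sub pe => x ex; exists x.
have [e' pe' [ue' us']] := pg_unitE psi.
have := Upsi h; rewrite (_ : germ _ = germ (pg_unit psi)) //.
apply: (@germ_same _ _ (Jcap e e')); rewrite ?us' //.
  by rewrite ev_cap; apply/andP.
by rewrite ue' => x y [/= ex e'x]; split=> -[_].
Qed.

Lemma gm_mul_continuous : {within [set p : germs * germs | gm_src p.1 = gm_rng p.2],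
  continuous (fun p : germs * germs => gm_mul p.1 p.2)}.
Proof.
apply/subspace_continuousP => -[g h] /=.
elim/germ_ind: g => p; elim/germ_ind: h => q.
rewrite gm_srcE gm_rngE => pq U.
move=> Ugm; have {Ugm} : nbhs (gm_mul (germ p) (germ q)) U by exact: Ugm.
rewrite gm_mulE // => /germ_near.
rewrite pg_mul_src pg_mul_elt // => nU.
have [V [oV Vq VU]] : exists V : set Y, [/\ open V, V (pg_src q) &
    forall psi, V psi -> forall h : ev (val psi) (sdom (Ilcomp (pg_elt p) (pg_elt q))),
      U (germ (mkpg h))].
  have : nbhs (pg_src q) _ := nU.
  by rewrite nbhsE => -[V [oV Vq] VU]; exists V.
have nq : nbhs (germ q) (germ @` [set r | pg_elt r = pg_elt q /\ V (pg_src r)]).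
  apply: open_nbhs_nbhs; split; last by exists q.
  apply: germ_open; apply: pg_slice_open => r [rq Vr].
  by apply: filterS (open_nbhs_nbhs (conj oV Vr)) => psi.
have np : nbhs (germ p) (germ_slice (pg_elt p)).
  by apply: open_nbhs_nbhs; split; [exact: germ_slice_open|exists p].
exists (germ_slice (pg_elt p), germ @` [set r | pg_elt r = pg_elt q /\ V (pg_src r)]) => //.
move=> [_ _] [/= [p' pp' <-] [q' [qq' Vq'] <-]].
rewrite gm_srcE gm_rngE => pq'.
suff : U (gm_mul (germ p') (germ q')) by [].
rewrite gm_mulE //.
have h : ev (val (pg_src q')) (sdom (Ilcomp (pg_elt p) (pg_elt q))).
  by rewrite -pp' -qq'; exact: pg_mul_subproof.
rewrite (_ : pg_mul p' q' = mkpg h); first exact: VU.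
by apply: pg_eq; rewrite ?pg_mul_src ?pg_mul_elt // pp' qq'.
Qed.

Definition germ_groupoid : topGroupoid := TopGroupoid
  gm_src_unit gm_rng_unit gm_src_mul gm_rng_mul gm_mulA gm_mul_unitr gm_mul_unitl
  gm_src_inv gm_rng_inv gm_mulV gm_mulVl gm_src_continuous gm_rng_continuous
  gm_unit_continuous gm_inv_continuous gm_mul_continuous.

(* The source map is a homeomorphism from the slice of [s] onto
   $\{\chi\in Y : \chi(s^{-1}s) = 1\}$. *)
Lemma germ_slice_homeo s :
  [/\ set_bij (germ_slice s) [set chi : Y | ev (val chi) (sdom s)] gm_src,
      continuous gm_src &
      forall W : set germs, open W -> W `<=` germ_slice s ->
        open (gm_src @` W)].
Proof.
split; [split| |].
- by move=> _ [p ps <-]; rewrite /= gm_srcE -ps; exact: pgP.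
- move=> g h /set_mem[p ps <-] /set_mem[q qs <-]; rewrite !gm_srcE => pq.
  by congr germ; apply: pg_eq => //; rewrite ps qs.
- by move=> chi h; exists (germ (mkpg h)); [exists (mkpg h)|rewrite gm_srcE].
- exact: gm_src_continuous.
move=> W oW Ws; rewrite openE => _ [g Wg <-].
have [p ps pg] := Ws _ Wg; rewrite -pg in Wg *.
rewrite gm_srcE /interior.
have := germ_near (open_nbhs_nbhs (conj oW Wg)).
have psp := pgP p.
move=> /filterI/(_ (Y_near (pg_src p) (sdom (pg_elt p)))).
apply: filterS => psi [+ ]; rewrite psp => Wpsi h.
by exists (germ (mkpg h)); [exact: Wpsi|rewrite gm_srcE].
Qed.

End Germs.

(* $I_l \ltimes Y$ and $I_l \mathbin{\bar\ltimes} Y$ *)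
Definition Il_ltimes (C : lcCategory) (Y : invSubset C) : topGroupoid :=
  germ_groupoid (famJ C) Y.
Definition Il_ltimes_bar (C : lcCategory) (Y : invSubset C) : topGroupoid :=
  germ_groupoid (famJbar C) Y.

Definition germ_proj (C : lcCategory) (Y : invSubset C)
    (g : Il_ltimes Y) : Il_ltimes_bar Y :=
  germ (famJbar C) (germ_repr g).
Arguments germ_proj {C} Y.

Lemma germ_projE (C : lcCategory) (Y : invSubset C) (p : pregerm Y) :
  germ_proj Y (germ (famJ C) p) = germ (famJbar C) p.
Proof.
apply/germP/germ_relP.
have /germ_relP[src [A [e che ->] AE]] := repr_germ (famJ C) p.
split=> //; exists (val e) => //.
exists 0%N, e, (fun=> e); split=> //; last by case.
by split=> [[]//|]; rewrite bigcup0 ?setD0 // => -[].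
Qed.

(* Main.v *)
Require Import Defs.
From mathcomp Require Import all_boot all_classical topology.

(** Passing from $\sim$-germs to $\bar\sim$-germs only makes more germs equal,
    and both groupoids carry the quotient topology of the same space of pairs
    $(s, \chi)$; so the projection is an isomorphism as soon as it is injective
    ([germ_proj_isoP]): whenever $s$ and $t$ agree on some $\varepsilon$ in
    $\bar{\mathcal J}$ with $\chi(\varepsilon) = 1$, they must agree on some $e$
    in $\mathcal J$ with $\chi(e) = 1$.

    Under (i) this is known for every $\chi$ in $\Omega$, which contains
    $\partial\Omega$.

    For a maximal $\chi$ it always holds: if $\chi(f) = 0$, maximality provides
    $g$ with $\chi(g) = 1$ and $g \cap f = \emptyset$ ([Omega_max_disjoint]).  So
    if $\varepsilon = e \setminus \bigcup_i f_i$ and $\chi(\varepsilon) = 1$, then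
    $e \cap \bigcap_i g_i$ is an element of $\mathcal J$ inside $\varepsilon$ at
    which $\chi$ is 1 ([Omega_max_evbar]).  This settles (iii).

    Under (ii), let $s$ and $t$ agree on $\varepsilon$ with $\chi(\varepsilon) = 1$
    and $\chi$ in $\partial\Omega$.  They still have equal $\bar\sim$-germs at all
    characters near $\chi$, hence equal $\sim$-germs at the maximal ones among
    them.  As the maximal characters are dense in $\partial\Omega$, all
    neighbourhoods of $[s, \chi]$ and $[t, \chi]$ meet ([germ_bar_cluster]), so
    that these germs are equal in a Hausdorff space. *)

Set Implicit Arguments.
Unset Strict Implicit.
Unset Printing Implicit Defensive.

Local Open Scope classical_set_scope.

Section MaximalCharacters.
Context {C : lcCategory}.
Implicit Types (e f g : J C) (chi psi : Jhat C).

(** If every $g$ with $\chi(g) = 1$ meets $f$, then the upward closure of the sets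
    $g \cap f$ is again a character; it extends $\chi$ and takes the value 1 at
    $f$, so maximality forces $\chi(f) = 1$. *)
Lemma Omega_max_disjoint chi f : Omega_max C chi -> ~~ ev chi f ->
  exists2 g, ev chi g & val g `&` val f = set0.
Proof.
move=> mchi /negP nchf; apply: contrapT => nsep; apply: nchf.
have meet g : ev chi g -> exists x, (val g `&` val f) x.
  move=> chg; apply: contrapT => gf; apply: nsep; exists g => //.
  by apply/seteqP; split=> x // gfx; apply: gf; exists x.
pose p (a : J C) : bool :=
  `[< exists2 g, ev chi g & val g `&` val f `<=` val a >].
have [e che] := ev_ex chi.
have pJ : Jhat C p.
  split.
  - by exists e; apply/asboolP; exists e => // x [].
  - move=> a b; apply/asboolP/andP => [[g chg gab]|].
      by split; apply/asboolP; exists g => // x /gab[].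
    move=> [/asboolP[g chg ga] /asboolP[g' chg' gb]].
    exists (Jcap g g'); first by rewrite ev_cap chg.
    by move=> x [[gx g'x] fx]; split; [exact: ga|exact: gb].
  - move=> a a0; apply/asboolP => -[g /meet[x gx]] /(_ x gx).
    by rewrite [val a]a0.
pose psi : Jhat C := exist (fun x => x \in Jhat C) _ (mem_set pJ).
have chi_psi : [set e | ev chi e] `<=` [set e | ev psi e].
  by move=> a cha; apply/asboolP; exists a => // x [].
have /seteqP[/(_ f) + _] := mchi psi chi_psi; apply.
by apply/asboolP; exists e => // x [].
Qed.

Lemma Omega_max_evbar chi A : Omega_max C chi -> evbar chi A ->
  exists2 e, ev chi e & val e `<=` A.
Proof.
move=> mchi [n [e [f [[_ ->] che chf]]]].
have [|i|g chg gf] := @ev_all C chi n (fun i g => val g `&` val (f i) = set0).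
- move=> i g g' gg' g0; apply/seteqP; split=> x // [g'x fx].
  by have /seteqP[/(_ x) + _] := g0; apply; split=> //; exact: gg'.
- exact: Omega_max_disjoint (chf i).
exists (Jcap e g); first by rewrite ev_cap che.
move=> x [ex gx]; split=> // -[i _ fx].
by have /seteqP[/(_ x) + _] := gf i; apply.
Qed.

End MaximalCharacters.

Section Projection.
Context {C : lcCategory} {Y : invSubset C}.
Implicit Types p q : pregerm Y.

(** The topologies of both groupoids are quotients of that of [pregerm Y], so
    the set-theoretic inverse is continuous because its composite with one
    quotient map is the other quotient map. *)
Lemma germ_proj_isoP :
  topGroupoid_iso (germ_proj Y) <-> injective (germ_proj Y).
Proof.
split=> [[[F' [FK _ _ _]] _ _]|inj]; first exact: can_inj FK.
pose F' (g : Il_ltimes_bar Y) : Il_ltimes Y := germ (famJ C) (germ_repr g).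
have F'K : cancel F' (germ_proj Y).
  by move=> g; rewrite /F' germ_projE germ_reprK.
have FK : cancel (germ_proj Y) F' by move=> g; apply: inj; rewrite F'K.
have srcE (g : Il_ltimes Y) : gsrc (germ_proj Y g) = gsrc g.
  by elim/(@germ_ind _ (famJ C) Y): g => p; rewrite germ_projE /= !gm_srcE.
have rngE (g : Il_ltimes Y) : grng (germ_proj Y g) = grng g.
  by elim/(@germ_ind _ (famJ C) Y): g => p; rewrite germ_projE /= !gm_rngE.
split.
- exists F'; split=> //.
    apply/quotient_continuous; rewrite (_ : _ \o _ = @germ C (famJbar C) Y).
      exact: germ_continuous.
    by apply/funext => p; exact: germ_projE.
  apply/quotient_continuous; rewrite (_ : _ \o _ = @germ C (famJ C) Y).
    exact: germ_continuous.
  by apply/funext => p; apply: inj; rewrite F'K germ_projE.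
- by move=> g h; rewrite srcE rngE.
move=> g h; elim/(@germ_ind _ (famJ C) Y): g => p; elim/(@germ_ind _ (famJ C) Y): h => q /=.
rewrite gm_srcE gm_rngE => pq.
by rewrite gm_mulE // !germ_projE gm_mulE.
Qed.

Lemma germ_proj_injP : injective (germ_proj Y) <->
  forall p q, germ_rel (famJbar C) p q -> germ_rel (famJ C) p q.
Proof.
split=> [inj p q /germP pq|h g g'].
  by apply/germP/inj; rewrite !germ_projE.
elim/(@germ_ind _ (famJ C) Y): g => p; elim/(@germ_ind _ (famJ C) Y): g' => q.
by rewrite !germ_projE => /germP/h/germP.
Qed.

Lemma germ_bar_max p q : Omega_max C (val (pg_src p)) ->
  germ_rel (famJbar C) p q -> germ_rel (famJ C) p q.
Proof.
move=> mp /germ_relP[src [A FA pq]]; apply/germ_relP; split=> //.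
have [e che eA] := Omega_max_evbar mp FA.
by exists (val e); [exists e|move=> x y /eA; exact: pq].
Qed.

End Projection.

(** Enlarging $Y$ adds germs but identifies no further ones, since the germ
    relation at $\chi$ depends on $\chi$ alone. *)
Lemma germ_proj_inj_sub {C : lcCategory} (Y Z : invSubset C) :
  Y `<=` Z -> injective (germ_proj Z) -> injective (germ_proj Y).
Proof.
move=> YZ /germ_proj_injP inj; apply/germ_proj_injP => p q.
pose incl (chi : Y) : Z :=
  exist (fun x => x \in inv_set Z) (val chi) (mem_set (YZ _ (set_valP chi))).
pose widen (r : pregerm Y) : pregerm Z :=
  @mkpg C Z (pg_elt r) (incl (pg_src r)) (pgP r).
move=> /germ_relP[src AE].
have /germ_relP[_ eE] : germ_rel (famJ C) (widen p) (widen q).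
  by apply/inj/germ_relP; split=> //; exact: congr1 src.
exact/germ_relP.
Qed.

Section Closure.
Context {C : lcCategory}.
Local Notation Y := (bOmega_inv C).

Lemma Omega_max_dense (chi : Y) (P : set Y) : nbhs chi P ->
  exists2 psi : Y, Omega_max C (val psi) & P psi.
Proof.
move=> [_ [[O oO <-] /= Ochi OP]].
have [psi [mpsi Opsi]] := set_valP chi O (open_nbhs_nbhs (conj oO Ochi)).
have bpsi : inv_set Y psi := subset_closure mpsi.
by exists (exist (fun x => x \in inv_set Y) psi (mem_set bpsi)) => //; exact: OP.
Qed.

Lemma germ_bar_cluster (p q : pregerm Y) : germ_rel (famJbar C) p q ->
  cluster (nbhs (germ (famJ C) p)) (germ (famJ C) q).
Proof.
move=> /germ_relP[src [A FA pq]] U V Up Vq.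
have nU := germ_near Up; have nV := germ_near Vq; rewrite -src in nV.
have nd (r : pregerm Y) : pg_src p = pg_src r ->
    \forall psi \near pg_src p, ev (val psi) (sdom (pg_elt r)).
  by move=> ->; apply: filterS (Y_near _ (sdom (pg_elt r))) => psi ->; exact: pgP.
have vc : continuous (set_val : Y -> _) by exact: initial_continuous.
have nA : \forall psi \near pg_src p, famJbar C (val psi) A.
  exact: (vc (pg_src p) _ (fam_near FA)).
have [psi mpsi [[Upsi Vpsi] [[hp hq] Apsi]]] :=
  Omega_max_dense (filterI (filterI nU nV) (filterI (filterI (nd p erefl) (nd q src)) nA)).
exists (germ (famJ C) (mkpg hp)); split; first exact: Upsi.
suff -> : germ (famJ C) (mkpg hp) = germ (famJ C) (mkpg hq) by exact: Vpsi.
apply/germP/germ_bar_max => //.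
by apply/germ_relP; split=> //; exists A.
Qed.

End Closure.

Theorem lemma3p5 (C : lcCategory) :
  [\/ topGroupoid_iso (germ_proj (Omega_inv C)),
      hausdorff_space (Il_ltimes (bOmega_inv C)) |
      bOmega C = Omega_max C] ->
  topGroupoid_iso (germ_proj (bOmega_inv C)).
Proof.
move=> hyp; apply/germ_proj_isoP; case: hyp => [/germ_proj_isoP|hT2|bmax].
- exact/germ_proj_inj_sub/bOmega_sub.
- by apply/germ_proj_injP => p q /germ_bar_cluster/hT2/germP.
apply/germ_proj_injP => p q; apply: germ_bar_max.
by rewrite -bmax; exact: set_valP (pg_src p).
Qed.
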